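(* Let $n>k\ge 2$, and let $G$ be a $k$-connected graph on $n$ vertices. (a) We have \[ mc_k(G)\le e(G)-\left\lceil\frac{k\binom{n}{2}-e(G)}{n-2}\right\rceil+1. \] (b) If $e(G)=\lceil\frac{kn}{2}\rceil$, then $mc_k(G)=1$.
   Context: All graphs are finite, simple and undirected. A graph is $k$-connected if it has at least $k+1$ vertices and remains connected after deleting any at most $k-1$ vertices. Paths are called disjoint if they are internally vertex-disjoint. An edge-coloured path is monochromatic if all its edges have the same colour. For a $k$-connected graph $G$, an edge-colouring is monochromatic $k$-connected if any two vertices are connected by $k$ disjoint monochromatic paths; $mc_k(G)$ is the maximum number of colours in a monochromatic $k$-connected colouring of $G$. *)

(* Defs.v *)
From mathcomp Require Import all_boot all_order all_algebra.
From mathcomp Require Import boolp.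
Set Implicit Arguments. Unset Strict Implicit. Unset Printing Implicit Defensive.

Section Defs.
Variable T : finType.
(* A finite simple graph on vertex set T: adjacency e, assumed symmetric
   and irreflexive in the theorem. *)
Variable e : rel T.

Definition edges : {set {set T}} :=
  [set [set x; y] | x in T, y in T & e x y].

Definition nedges : nat := #|edges|.

Definition k_connected (k : nat) : Prop :=
  k.+1 <= #|T| /\
  forall S : {set T}, #|S| <= k.-1 ->
  forall u v, u \notin S -> v \notin S ->
    connect [rel x y | [&& e x y, x \notin S & y \notin S]] u v.

(* An edge-colouring: a function from (2-sets of) vertices to colours; only
   its values on edges matter. *)
Variable C : finType.
Implicit Type c : {ffun {set T} -> C}.

Definition ncolours c : nat := #|c @: edges|.

Definition mono_path c (col : C) (u v : T) (p : seq T) : bool :=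
  [&& path [rel x y | e x y && (c [set x; y] == col)] u p,
      last u p == v & uniq (u :: p)].

(* internal vertices of the path u :: p (u and the last vertex removed) *)
Definition interior (p : seq T) : seq T := take (size p).-1 p.

Definition mono_k_connected (k : nat) c : Prop :=
  forall u v : T, u != v ->
  exists ps : seq (seq T),
    [/\ size ps = k, uniq ps,
        (forall p, p \in ps -> exists col, mono_path c col u v p) &
        (forall i j, i < size ps -> j < size ps -> i != j ->
           [disjoint interior (nth [::] ps i) & interior (nth [::] ps j)])].

End Defs.

(* mc_k(G): the maximum number of colours in a monochromatic k-connected
   colouring.  Colourings with at most e(G)+1 colour values suffice (any
   colouring uses at most e(G) colours and can be relabelled). *)
Definition mc (T : finType) (e : rel T) (k : nat) : nat :=
  \max_(c : {ffun {set T} -> 'I_(nedges e).+1} | `[< mono_k_connected e k c >])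
     ncolours e c.

(* Main.v *)
(** Fix [k] disjoint monochromatic paths for every pair of vertices.  For ordered
    triples [(u, w, v)] with [uw] an edge and [v] a third vertex, call the triple
    wasted if no path of the pair [u, v] starts with [uw].  Counting edges at [u]
    shows [k n (n - 1) + #wasted <= 2 e(G) (n - 1)], so (a) follows from
    [#wasted >= 2 (t - 1) (n - 2)], where [t] is the number of colours.  A colour with
    a component [K] that is not spanning wastes [2 (|K| - 1) (n - |K|) >= 2 (n - 2)]
    triples of its own, since paths of that colour never leave [K].  If two colours
    are connected and spanning and [uw], [wv] have different ones among them, then
    [(u, w, v)] or [(v, w, u)] is wasted: otherwise [w] is interior to two paths of
    different colours.  In (b) the same inequality leaves no room for a second
    colour, and the constant colouring is admissible by Menger's theorem, which is
    derived from Hall's theorem following Ingleton and Piff. *)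

Require Import Defs.
From mathcomp Require Import all_boot all_order all_algebra.
From mathcomp Require Import boolp zify.
Import GRing.Theory Num.Theory.

Set Implicit Arguments. Unset Strict Implicit. Unset Printing Implicit Defensive.

(** * Hall and Menger *)

Definition hall_condition (L R : finType) (N : L -> {set R}) :=
  forall X : {set L}, #|X| <= #|\bigcup_(x in X) N x|.

(* Rado's argument: in a family minimal for Hall's condition all sets are
   singletons, since by submodularity one of two points of N x is removable. *)
Lemma hall (L R : finType) (N : L -> {set R}) :
  hall_condition N -> exists2 f : L -> R, injective f & forall x, f x \in N x.
Proof.
have [m] := ubnP (\sum_x #|N x|); elim: m N => // m IHm N ltm hN.
have [/forallP N1|/forallPn[x /negPf Nx]] := boolP [forall x, #|N x| == 1].
  have /choice[f fP] : forall x, exists y, N x = [set y].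
    by move=> x; apply/cards1P.
  exists f => [x y eqf|x]; last by rewrite fP set11.
  apply/eqP; apply: contraT => neq_xy; have := hN [set x; y].
  by rewrite cards2 neq_xy bigcup_setU !big_set1 !fP eqf setUid cards1.
pose N' y z := if z == x then N x :\ y else N z.
(* Shrinking [N x] alters no other set, so a violator of Hall's condition for [N' y] must contain
   [x]. *)
have N'_bad y : y \in N x -> (exists2 f : L -> R, injective f & forall x, f x \in N x)
    \/ exists2 X : {set L}, x \in X & #|\bigcup_(z in X) N' y z| < #|X|.
  move=> Ny; have N'N z : N' y z \subset N z.
    by rewrite /N'; case: eqP => [->|//]; rewrite subD1set.
  have [hN'|] := pselect (hall_condition (N' y)).
    left; have [|f injf fP] := IHm (N' y) _ hN'.
      rewrite ltnS in ltm; apply: leq_trans ltm.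
      rewrite (bigD1 x) //= [X in _ < X](bigD1 x) //= -addSn leq_add //.
        by rewrite /N' eqxx (cardsD1 y (N x)) Ny.
      by apply: leq_sum => z _; apply: subset_leq_card.
    by exists f => // z; apply: (subsetP (N'N z)).
  move=> /existsNP[X /negP]; rewrite -ltnNge => ltX; right; exists X => //.
  apply: contraLR ltX => xX; rewrite -leqNgt; apply: leq_trans (hN X) _.
  apply: subset_leq_card; apply/bigcupsP => z zX; apply: (bigcup_max z zX).
  by rewrite /N'; case: eqP zX xX => // -> ->.
have: 1 < #|N x|.
  have := hN [set x]; rewrite big_set1 cards1 leq_eqVlt eq_sym Nx //.
move=> /card_gt1P[y1 [y2 [Ny1 Ny2 neq_y]]].
have [//|[X1 xX1 lt1]] := N'_bad _ Ny1.
have [//|[X2 xX2 lt2]] := N'_bad _ Ny2.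
set A1 := \bigcup_(_ in _) _ in lt1; set A2 := \bigcup_(_ in _) _ in lt2.
(* As [y1] and [y2] differ, [N x] minus [y1] and [N x] minus [y2] together cover [N x], so the union
   loses nothing. *)
have leU : #|X1 :|: X2| <= #|A1 :|: A2|.
  apply: leq_trans (hN _) _; apply/subset_leq_card/bigcupsP => z zX.
  have [->|neq_zx] := eqVneq z x.
    apply/subsetP => y Ny; rewrite inE.
    have [->|neq_y1] := eqVneq y y1.
      apply/orP; right; apply/bigcupP; exists x => //.
      by rewrite /N' eqxx !inE neq_y.
    apply/orP; left; apply/bigcupP; exists x => //.
    by rewrite /N' eqxx !inE neq_y1.
  case/setUP: zX => zX; [apply: subset_trans (subsetUl _ _)|
    apply: subset_trans (subsetUr _ _)]; apply: (bigcup_max z zX);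
    by rewrite /N' (negPf neq_zx).
(* In the intersection only the set of [x] has shrunk; dropping [x] costs the one unit. *)
have leI : #|X1 :&: X2| <= #|A1 :&: A2|.+1.
  rewrite (cardsD1 x) !inE xX1 xX2 add1n ltnS; apply: leq_trans (hN _) _.
  apply/subset_leq_card/bigcupsP => z; rewrite !inE => /and3P[neq_zx z1 z2].
  rewrite subsetI; apply/andP; split; apply: (bigcup_max z) => //;
    by rewrite /N' (negPf neq_zx).
have := cardsUI X1 X2; have := cardsUI A1 A2; lia.
Qed.

Lemma connect_stable (T : finType) (r : rel T) (a : {pred T}) x y :
  (forall z z', z \in a -> r z z' -> z' \in a) -> connect r x y ->
  x \in a -> y \in a.
Proof.
move=> ra /connectP[p + ->]; elim: p x => //= z p IHp x /andP[rxz pzp] xa.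
by apply: IHp pzp _; apply: ra rxz.
Qed.

(** * Menger's theorem for two non-adjacent vertices *)

Section Menger.
Variables (T : finType) (e : rel T) (k : nat) (u v : T).
Hypotheses (neq_uv : u != v) (nuv : ~~ e u v).
Hypothesis sep : forall S : {set T}, #|S| < k -> u \notin S -> v \notin S ->
  connect [rel x y | [&& e x y, x \notin S & y \notin S]] u v.

Definition inner x := (x != u) && (x != v).

(* [inr i] stands both for a copy of [u], as a source, and for a copy of [v], as
   a target; loops at the [inl x] account for the vertices on no path. *)
Definition link (a b : T + 'I_k) : bool :=
  match a, b with
  | inl x, inl y => (x == y) || [&& e x y, inner x & inner y]
  | inl x, inr _ => inner x && e x v
  | inr _, inl y => inner y && e u y
  | inr _, inr _ => false
  end.

(** Loops put every [inl] element of [X] into [N], so in the hard case [X] contains a source. Either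
    some inner vertex of [X'] exits to [v], and all [k] targets lie in [N], or the set [S] of newly
    reached inner vertices separates [u] from [v] and so has at least [k] elements. *)
Lemma link_hall : hall_condition (fun a => [set b | link a b]).
Proof.
move=> X; set N := \bigcup_(_ in _) _.
pose X' := [set x | inl x \in X].
have in_N a b : a \in X -> link a b -> b \in N.
  by move=> aX ab; apply/bigcupP; exists a => //; rewrite inE.
have [sXN|] := boolP (X \subset N); first exact: subset_leq_card.
case/subsetPn => -[x xX|i iX _]; first by rewrite (in_N (inl x)) //= eqxx.
have leX : #|X| <= #|X'| + k.
  have: X \subset (@inl T 'I_k @: X') :|: (@inr T 'I_k @: setT).
    apply/subsetP => -[x|j] jX; rewrite inE; last by rewrite (imset_f _ (in_setT j)) orbT.
    by rewrite imset_f // inE.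
  move=> /subset_leq_card/leq_trans; apply.
  apply: leq_trans (leq_card_setU _ _) _.
  by rewrite leq_add ?leq_imset_card // (leq_trans (leq_imset_card _ _)) ?cardsT ?card_ord.
apply: leq_trans leX _.
have [/existsP[x /and3P[xX' ix exv]]|/existsPn noexit] :=
  boolP [exists x, [&& x \in X', inner x & e x v]].
  have: (@inl T 'I_k @: X') :|: (@inr T 'I_k @: setT) \subset N.
    apply/subsetP => b /setUP[]/imsetP[z + ->].
      by rewrite inE => zX; apply: in_N zX _; rewrite /= eqxx.
    by move=> _; apply: (in_N (inl x)); rewrite ?inE // in xX' *; rewrite /= ix.
  move/subset_leq_card; apply: leq_trans.
  rewrite cardsU disjoint_setI0 ?cards0 ?subn0; last first.
    by rewrite disjoints_subset; apply/subsetP => _ /imsetP[y _ ->]; rewrite inE; apply/imsetP => -[].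
  by rewrite !card_imset ?cardsT ?card_ord //; [move=> ? ? []|move=> ? ? []].
pose S := [set y | [&& y \notin X', inner y &
  [exists z, (z \in u |: [set x in X' | inner x]) && e z y]]].
have: @inl T 'I_k @: (X' :|: S) \subset N.
  apply/subsetP => _ /imsetP[y /setUP[yX|yS] ->].
    by apply: (in_N (inl y)); rewrite ?inE // in yX *; rewrite /= eqxx.
  move: yS; rewrite inE => /and3P[_ iy /existsP[z /andP[]]].
  case/setU1P => [->|]; first by move=> euy; apply: (in_N (inr i)) => //=; rewrite iy.
  rewrite !inE => /andP[zX iz] ezy; apply: (in_N (inl z)) => //=.
  by rewrite ezy iz iy orbT.
move/subset_leq_card; apply: leq_trans; rewrite card_imset; last by move=> ? ? [].
rewrite cardsU disjoint_setI0 ?cards0 ?subn0 ?leq_add2l; last first.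
  by rewrite disjoints_subset; apply/subsetP => y yX; rewrite !inE in yX *; rewrite yX.
rewrite leqNgt; apply/negP => /sep; rewrite !inE /inner !eqxx !andbF => /(_ isT isT) uv.
(* This set is closed under steps avoiding [S], since by [nuv] and [noexit] no edge leads from it to
   [v]. *)
suff: v \in u |: [set x in X' | inner x].
  by rewrite !inE eq_sym (negPf neq_uv) /inner eqxx !andbF.
apply: connect_stable uv _; last by rewrite setU11.
move=> z z' za /and3P[ezz' _ z'S]; apply: contraR z'S => z'a.
have z'u : z' != u by apply: contraNneq z'a => ->; rewrite setU11.
have z'v : z' != v.
  apply: contraTneq ezz' => ->; case/setU1P: za => [->//|].
  rewrite !inE => /andP[zX iz].
  by have := noexit z; rewrite inE zX iz.
have iz' : inner z' by rewrite /inner z'u.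
rewrite inE iz' /=; apply/andP; split; last by apply/existsP; exists z; rewrite za.
by apply: contraNN z'a => z'X; rewrite inE; apply/orP; right; rewrite inE z'X.
Qed.

(** Hall's injective choice permutes a finite set. Following it from the source [inr i] up to the
    first target traces a path, and injectivity keeps these paths disjoint. *)
Lemma menger : exists q : 'I_k -> seq T,
  (forall i, [/\ q i != [::], path e u (rcons (q i) v)
               & uniq (u :: rcons (q i) v)]) /\
  (forall i j, i != j -> [disjoint q i & q j]).
Proof.
have [f injf fN] := hall link_hall.
have fP a : link a (f a) by have := fN a; rewrite inE.
pose isr (a : T + 'I_k) := if a is inr _ then true else false.
have ret i : exists n, isr (iter n.+1 f (inr i)).
  have := iter_order injf (inr i); rewrite -(prednK (order_gt0 f (inr i))) => ri.
  by exists (order f (inr i)).-1; rewrite ri.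
(* [l i] counts the steps before the first return to a copy. The value [u] of [g] on copies makes
   [pq] below correct for the empty prefix. *)
pose l i := ex_minn (ret i); pose g (a : T + 'I_k) := if a is inl x then x else u.
have lP i : isr (iter (l i).+1 f (inr i)) by rewrite /l; case: ex_minnP.
have lmin i j : j < l i -> exists2 y, iter j.+1 f (inr i) = inl y & inner y.
  have nr m : m < l i -> ~~ isr (iter m.+1 f (inr i)).
    rewrite /l; case: ex_minnP => n _ nmin ltmn.
    by apply: contraL ltmn => /nmin; rewrite -leqNgt.
  elim: j => [|j IHj] ltj; have := nr _ ltj; rewrite iterS.
    by have := fP (inr i); rewrite /=; case: (f _) => //= y /andP[iy _]; exists y.
  have [x -> ix] := IHj (ltnW ltj); have := fP (inl x).
  case: (f _) => //= y /orP[/eqP<-|/and3P[_ _ iy] _]; first by exists x.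
  by exists y.
have lgt0 i : 0 < l i.
  by have := lP i; case: (l i) => //=; have := fP (inr i); case: (f _).
have iterK m (a b : T + 'I_k) : iter m f a = iter m f b -> a = b.
  by elim: m => //= m IHm /injf.
(* Cancelling common iterations when [j < j'] would bring the orbit of [inr i'] back to a copy
   before its first return. *)
have inj_le i i' j j' : j <= j' -> j' < l i' ->
    iter j.+1 f (inr i) = iter j'.+1 f (inr i') -> j = j' /\ i = i'.
  move=> lejj' ltj'; rewrite -(subnKC lejj') -addSn iterD => /iterK.
  case def_d: (j' - j) => [|d]; first by rewrite addn0 => -[].
  by have [|y -> //] := lmin i' d; lia.
have inj_orb i i' j j' : j < l i -> j' < l i' ->
    g (iter j.+1 f (inr i)) = g (iter j'.+1 f (inr i')) -> j = j' /\ i = i'.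
  move=> ltj ltj' eqg.
  have {eqg} : iter j.+1 f (inr i) = iter j'.+1 f (inr i').
    by move: eqg; have [y -> _] := lmin _ _ ltj; have [y' -> _] := lmin _ _ ltj' => /= ->.
  case: (leqP j j') => [le|/ltnW le] eqi; first exact: inj_le eqi.
  by have [] := inj_le _ _ _ _ le ltj (esym eqi).
have inner_orb i j : j < l i -> inner (g (iter j.+1 f (inr i))).
  by move=> /lmin[y -> iy].
pose q i := mkseq (fun j => g (iter j.+1 f (inr i))) (l i).
exists q; split=> [i|i i' neq_i]; last first.
  apply/pred0P => x /=; apply/negP => /andP[/mapP[j]].
  rewrite mem_iota => /andP[_ ltj] -> /mapP[j']; rewrite mem_iota => /andP[_ ltj'].
  by case/inj_orb => // _ eqi; rewrite eqi eqxx in neq_i.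
have q_inner x : x \in q i -> inner x.
  by case/mapP => j; rewrite mem_iota => /andP[_ ltj] ->; apply: inner_orb.
split; first by rewrite -size_eq0 size_mkseq -lt0n.
  have pq m : m <= l i -> path e u (mkseq (fun j => g (iter j.+1 f (inr i))) m)
      /\ last u (mkseq (fun j => g (iter j.+1 f (inr i))) m) = g (iter m f (inr i)).
    elim: m => // m IHm ltm; have [pm lm] := IHm (ltnW ltm).
    rewrite mkseqS rcons_path last_rcons pm lm /=; split => //.
    have [y] := lmin _ _ ltm.
    case: m ltm {IHm pm lm} => [_|m ltm].
      by rewrite /=; have := fP (inr i); case: (f _) => //= z /andP[].
    have [x defx _] := lmin _ _ (ltnW ltm).
    have := @inj_orb i i m m.+1 (ltnW ltm) ltm.
    rewrite iterS -/(iter m.+1 f (inr i)) [iter m.+2 _ _]iterS defx /= => + defy.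
    have := fP (inl x); rewrite defy /=.
    (* A loop would repeat a vertex of the orbit. *)
    by case/orP => [/eqP-> /(_ erefl)[/n_Sn]|/and3P[]].
  have [pq1 lq] := pq _ (leqnn _); rewrite rcons_path pq1 lq /=.
  have := lP i; rewrite iterS; have ltl : (l i).-1 < l i by rewrite prednK.
  have [x + _] := lmin _ _ ltl; rewrite prednK // => -> /=.
  by have := fP (inl x); case: (f _) => //= j /andP[].
rewrite /= mem_rcons inE negb_or neq_uv /= rcons_uniq.
apply/and3P; split.
- by apply/negP => /q_inner; rewrite /inner eqxx.
- by apply/negP => /q_inner; rewrite /inner eqxx andbF.
rewrite map_inj_in_uniq ?iota_uniq // => j j'; rewrite !mem_iota => /andP[_ ltj] /andP[_ ltj'].
by case/inj_orb.
Qed.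

End Menger.

(** * Admissibility of the constant colouring *)

Lemma interior_rcons (T : finType) (q : seq T) x : interior (rcons q x) = q.
Proof. by rewrite /interior size_rcons /= -cats1 take_size_cat. Qed.

Section ConstantColouring.
Variables (T : finType) (e : rel T) (k : nat).
Hypothesis hG : k_connected e k.

(* For adjacent [u] and [v], delete the edge: as there is a third vertex [w] outside
   [S], connecting it to [u] off [S :|: [set v]] and to [v] off [S :|: [set u]]
   shows that [k.-1] paths remain. *)
Lemma connected_but_edge u v (S : {set T}) : u != v -> #|S| < k.-1 ->
  u \notin S -> v \notin S ->
  connect [rel x y | [&& e x y && ~~ ((x == u) && (y == v)),
                         x \notin S & y \notin S]] u v.
Proof.
move=> neq_uv ltS uS vS; have [ltkT conn] := hG.
have [w] : exists w, w \notin u |: (v |: S).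
  apply/existsP; rewrite -negb_forall; apply/negP => /forallP all_in.
  have : #|T| <= #|u |: (v |: S)|.
    by rewrite -cardsT; apply/subset_leq_card/subsetP => z _; apply: all_in.
  by rewrite !cardsU1; lia.
rewrite !inE !negb_or => /and3P[wu wv wS].
have leS x : #|x |: S| <= k.-1 by rewrite cardsU1; lia.
apply: (@connect_trans _ _ w).
  have := conn _ (leS v) u w; rewrite !inE !negb_or neq_uv uS wv wS.
  move=> /(_ isT isT); apply: connect_sub => x y /and3P[exy].
  rewrite !inE !negb_or => /andP[_ xS] /andP[yv yS]; apply: connect1.
  by rewrite /= exy (negPf yv) andbF xS yS.
have := conn _ (leS u) w v; rewrite !inE !negb_or eq_sym [v == u]eq_sym neq_uv vS eq_sym wu wS.
move=> /(_ isT isT); apply: connect_sub => x y /and3P[exy].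
rewrite !inE !negb_or => /andP[xu xS] /andP[yv yS]; apply: connect1.
by rewrite /= exy (negPf xu) xS yS.
Qed.

(** For an edge [uv], the path [[:: v]] joins the [k.-1] paths that [menger] finds once the arc from
    [u] to [v] is deleted; other pairs are covered by [menger] directly. *)
Lemma constant_mono_k_connected (C : finType) (a : C) :
  0 < k -> mono_k_connected e k [ffun _ => a].
Proof.
move=> k_gt0 u v neq_uv.
have mono_const (r : rel T) p : subrel r e -> path r u p -> last u p = v ->
    uniq (u :: p) -> exists col, Defs.mono_path e [ffun _ => a] col u v p.
  move=> sre rp lp up; exists a; rewrite /Defs.mono_path up lp eqxx !andbT.
  by apply: sub_path rp => x y /sre /= ->; rewrite ffunE eqxx.
have from_menger m (r : rel T) : subrel r e ->
    (exists q : 'I_m -> seq T,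
      (forall i, [/\ q i != [::], path r u (rcons (q i) v)
               & uniq (u :: rcons (q i) v)]) /\
      (forall i j, i != j -> [disjoint q i & q j])) ->
    exists2 ps : seq (seq T),
    [/\ size ps = m, uniq ps, (forall p, p \in ps -> 1 < size p) &
        (forall p, p \in ps -> exists col, Defs.mono_path e [ffun _ => a] col u v p)] &
        (forall i j, i < size ps -> j < size ps -> i != j ->
           [disjoint interior (nth [::] ps i) & interior (nth [::] ps j)]).
  move=> sre [q [qP qdis]]; exists [seq rcons (q i) v | i <- enum 'I_m].
    split; first by rewrite size_map size_enum_ord.
    - rewrite map_inj_uniq ?enum_uniq // => i j /rcons_inj[eqq].
      apply/eqP; apply: contraT => /qdis; rewrite eqq.
      case: (q j) (qP j) => [[]//|x s _] /pred0P/(_ x).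
      by rewrite /= mem_head.
    - move=> p /mapP[i _ ->]; have [+ _ _] := qP i.
      by rewrite size_rcons ltnS -size_eq0 lt0n.
    move=> p /mapP[i _ ->]; have [_ pq uq] := qP i.
    by apply: mono_const pq _ uq => //; rewrite last_rcons.
  move=> i j; rewrite size_map size_enum_ord => lti ltj neq_ij.
  have nthq n (ltn : n < m) :
      nth [::] [seq rcons (q i) v | i <- enum 'I_m] n = rcons (q (Ordinal ltn)) v.
    have sz := size_enum_ord m.
    rewrite (@nth_map _ (Ordinal ltn) _ [::] _ n (enum 'I_m)) ?sz //.
    by rewrite (nth_ord_enum _ (Ordinal ltn)).
  by rewrite (nthq _ lti) (nthq _ ltj) !interior_rcons; apply: qdis.
have [euv|nuv] := boolP (e u v).
  have [||ps [sz_ps ps_uniq ps_gt1 psP] psdis] :=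
    from_menger k.-1 [rel x y | e x y && ~~ ((x == u) && (y == v))].
  - by move=> x y /andP[].
  - apply: menger => //; first by rewrite /= !eqxx andbF.
    by move=> S ltS uS vS; apply: connected_but_edge.
  exists ([:: v] :: ps); split.
  - by rewrite /= sz_ps prednK.
  - by rewrite /= ps_uniq andbT; apply/negP => /ps_gt1.
  - move=> p /predU1P[->|]; last exact: psP.
    by apply: (mono_const e) => //=; rewrite ?euv // inE neq_uv.
  case=> [|i] [|j] //= lti ltj neq_ij.
  - by rewrite /interior /=; apply/pred0P => x.
  - by rewrite /interior /=; apply/pred0P => x; rewrite /= andbF.
  by apply: psdis.
have [||ps [sz_ps ps_uniq ps_gt1 psP] psdis] := from_menger k e => //.
  apply: menger => // S ltS uS vS; have [_ conn] := hG.
  by apply: conn => //; rewrite -ltnS prednK.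
by exists ps.
Qed.

End ConstantColouring.

(** * Counting wasted triples *)

(** Growing a tree from [x] adds, with each new vertex, one edge in both orientations. *)
Lemma arcs_of_component (T : finType) (r : rel T) x
    (K := [set y | connect r x y]) : symmetric r ->
  #|K|.-1.*2 <= #|[set p : T * T | [&& p.1 \in K, p.2 \in K & r p.1 p.2]]|.
Proof.
move=> r_sym; pose arcs (S : {set T}) := [set p : T * T | [&& p.1 \in S, p.2 \in S & r p.1 p.2]].
have xK : x \in K by rewrite inE.
have K_gt0 : 0 < #|K| by apply/card_gt0P; exists x.
suff grow s : s < #|K| -> exists S : {set T},
    [/\ x \in S, S \subset K, #|S| = s.+1 & s.*2 <= #|arcs S|].
  have [|S [_ sSK cardS leS]] := grow #|K|.-1; first by rewrite prednK.
  suff eqSK : S = K by move: leS; rewrite eqSK.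
  by apply/eqP; rewrite eqEcard sSK cardS (prednK K_gt0) leqnn.
elim: s => [|s IHs] lts; first by exists [set x]; rewrite set11 sub1set xK cards1.
have [S [xS sSK cardS leS]] := IHs (ltnW lts).
have [y yK yS] : exists2 y, y \in K & y \notin S.
  by apply/subsetPn; apply: contraL lts => /subset_leq_card; rewrite cardS -leqNgt.
have /existsP[z /existsP[z' /and3P[zS z'S rzz']]] :
    [exists z, exists z', [&& z \in S, z' \notin S & r z z']].
  apply: contraR yS => /existsPn nox; rewrite inE in yK.
  apply: connect_stable yK xS => z z' zS rzz'.
  by have /existsPn/(_ z') := nox z; rewrite zS rzz' andbT negbK.
exists (z' |: S); rewrite setU1r // subUset sub1set sSK cardsU1 z'S cardS; split=> //.
  have := subsetP sSK _ zS; rewrite !inE andbT => xz.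
  exact: connect_trans xz (connect1 rzz').
have z'z : (z', z) \notin (z, z') |: arcs S.
  by rewrite !inE /= (negPf z'S) /= orbF; apply: contraNneq z'S => -[->].
have zz' : (z, z') \notin arcs S by rewrite inE /= (negPf z'S) andbF.
have sub : (z', z) |: ((z, z') |: arcs S) \subset arcs (z' |: S).
  apply/subsetP => -[p p']; rewrite !inE /= => /or3P[/eqP[-> ->]|/eqP[-> ->]|].
  - by rewrite eqxx zS r_sym rzz' orbT.
  - by rewrite eqxx zS rzz' orbT.
  by case/and3P => -> -> ->; rewrite !orbT.
by apply: leq_trans (subset_leq_card sub); rewrite !cardsU1 z'z zz' doubleS !add1n !ltnS.
Qed.

Section Counting.
Variables (T : finType) (e : rel T) (k : nat).
Hypotheses (e_sym : symmetric e) (e_irr : irreflexive e).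
Variables (C : finType) (c : {ffun {set T} -> C}).

Definition col x y := c [set x; y].
Definition crel a := [rel x y | e x y && (col x y == a)].

Lemma colC x y : col x y = col y x.
Proof. by rewrite /col setUC. Qed.

Lemma crel_sym a : symmetric (crel a).
Proof. by move=> x y; rewrite /= e_sym colC. Qed.

Lemma connect_crelC a x y : connect (crel a) x y = connect (crel a) y x.
Proof. exact: (sym_connect_sym (@crel_sym a)). Qed.

(* [A] will consist of the second vertices of the non-trivial paths in a system of [k]
   disjoint monochromatic paths from [u] to [v]. *)
Definition first_neighbours u v (A : {set T}) :=
  [/\ forall w, w \in A -> e u w && (w != v), k <= #|A| + e u v
    & forall w, w \in A -> connect (crel (col u w)) w v].

(** Serves both ends at once: [head u p] and [b] are the vertices of the path next to [u] and next
    to [v]. *)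
Lemma nontrivial_mono_path a u v p : u != v ->
  Defs.mono_path e c a u v p -> p != [:: v] ->
  let b := last u (interior p) in
  [/\ head u p \in interior p, b \in interior p,
      [/\ crel a u (head u p), head u p != v & connect (crel a) (head u p) v]
    & [/\ crel a v b, b != u & connect (crel a) b u]].
Proof.
move=> neq_uv /and3P[]; case: (lastP p) => [|q x].
  by rewrite /= => _ uv; rewrite uv in neq_uv.
rewrite last_rcons => + /eqP def_x; rewrite {x}def_x => pp up.
case: q pp up => [|w q]; first by rewrite eqxx.
rewrite interior_rcons rcons_cons /= rcons_path => /andP[uw /andP[wq qv]].
rewrite inE !mem_rcons rcons_uniq !inE !negb_or.
move=> /and3P[/and3P[neq_uw _ uq] /andP[neq_wv _] _] _.
set b := last w q; have b_in : b \in w :: q by apply: mem_last.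
have wb : connect (crel a) w b by apply/connectP; exists q.
have buv : connect (crel a) b v by apply: connect1.
split; [exact: predU1l | exact: b_in | split=> // | split].
- exact: connect_trans buv.
- by have := crel_sym a b v; rewrite /= => <-.
- by apply: contraTneq b_in => ->; rewrite inE negb_or neq_uw.
by rewrite connect_crelC; apply: connect_trans wb; apply: connect1.
Qed.

(** Both sets are read off one path system, so a vertex in both is interior to a single path, whose
    colour both edges carry. *)
Lemma first_neighbours_pair u v : mono_k_connected e k c -> u != v ->
  exists AB : {set T} * {set T}, [/\ first_neighbours u v AB.1,
    first_neighbours v u AB.2
    & forall w, w \in AB.1 -> w \in AB.2 -> col u w = col v w].
Proof.
move=> mc neq_uv; have [ps [sz_ps ps_uniq psP psdis]] := mc _ _ neq_uv.
have in_interior p p' x : p \in ps -> p' \in ps ->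
    x \in interior p -> x \in interior p' -> p = p'.
  move=> p_in p'_in xp xp'; apply/eqP; apply: contraT => neq_pp'.
  have := psdis (index p ps) (index p' ps); rewrite !index_mem !nth_index //.
  rewrite p_in p'_in (inj_in_eq (@index_inj _ [::] ps)) // => /(_ isT isT neq_pp').
  by move=> /pred0P/(_ x); rewrite /= xp xp'.
pose nps := [seq p <- ps | p != [:: v]].
have npsP p : p \in nps -> p \in ps /\ exists a, let b := last u (interior p) in
  [/\ head u p \in interior p, b \in interior p,
      [/\ crel a u (head u p), head u p != v & connect (crel a) (head u p) v]
    & [/\ crel a v b, b != u & connect (crel a) b u]].
  rewrite mem_filter => /andP[nt p_in]; split=> //.
  by have [a pa] := psP p p_in; exists a; apply: nontrivial_mono_path nt.
(* Only [[:: v]] is dropped; it occurs at most once and needs the edge [uv]. *)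
have nps_size : k <= size nps + e u v.
  rewrite -sz_ps -(count_predC (pred1 [:: v]) ps) size_filter addnC leq_add2l.
  rewrite count_uniq_mem //; case: (boolP (_ \in ps)) => // /psP[a].
  by case/and3P => /andP[/andP[->]].
have card_nps (h : seq T -> T) : (forall p, p \in nps -> h p \in interior p) ->
    #|[set:: map h nps]| = size nps.
  move=> hP; rewrite cardsE; have /card_uniqP-> : uniq (map h nps).
    rewrite map_inj_in_uniq ?filter_uniq // => p p' p_in p'_in eq_h.
    have [p_ps _] := npsP _ p_in; have [p'_ps _] := npsP _ p'_in.
    by apply: (in_interior p p' (h p)) => //; [|rewrite eq_h]; apply: hP.
  by rewrite size_map.
exists ([set:: map (head u) nps], [set:: map (fun p => last u (interior p)) nps]).
split; [split | split |].
- move=> w; rewrite inE => /mapP[p p_in ->].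
  by have [_ [a [_ _ [/andP[-> _] -> _] _]]] := npsP _ p_in.
- by rewrite card_nps // => p /npsP[_ [a []]].
- move=> w; rewrite inE => /mapP[p p_in ->].
  by have [_ [a [_ _ [/andP[_ /eqP->] _ ?] _]]] := npsP _ p_in.
- move=> w; rewrite inE => /mapP[p p_in ->].
  by have [_ [a [_ _ _ [/andP[-> _] -> _]]]] := npsP _ p_in.
- by rewrite e_sym card_nps // => p /npsP[_ [a []]].
- move=> w; rewrite inE => /mapP[p p_in ->].
  by have [_ [a [_ _ _ [/andP[_ /eqP->] _ ?]]]] := npsP _ p_in.
move=> w; rewrite !inE => /mapP[p p_in ->] /mapP[p' p'_in eq_hl].
have [p_ps [a [hp lp [/andP[_ /eqP->] _ _] [/andP[_ /eqP<-] _ _]]]] := npsP _ p_in.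
have [p'_ps [a' [_ lp' _ _]]] := npsP _ p'_in.
by rewrite eq_hl (in_interior p p' (head u p)) // eq_hl.
Qed.

Lemma first_neighbours_family : mono_k_connected e k c ->
  exists F : T -> T -> {set T}, forall u v, u != v ->
    first_neighbours u v (F u v) /\
    forall w, w \in F u v -> w \in F v u -> col u w = col v w.
Proof.
move=> mc.
have /choice[G GP] : forall uv : T * T, exists AB : {set T} * {set T},
    uv.1 != uv.2 -> [/\ first_neighbours uv.1 uv.2 AB.1,
    first_neighbours uv.2 uv.1 AB.2
    & forall w, w \in AB.1 -> w \in AB.2 -> col uv.1 w = col uv.2 w].
  move=> [u v] /=; have [->|/(first_neighbours_pair mc)[AB ABP]] := eqVneq u v.
    by exists (set0, set0).
  by exists AB.
(* Ranking the vertices makes [F u v] and [F v u] come from the same choice. *)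
exists (fun u v => if enum_rank u < enum_rank v then (G (u, v)).1 else (G (v, u)).2).
move=> u v neq_uv; have [/= Auv Bvu eqc] := GP (u, v) neq_uv.
rewrite eq_sym in neq_uv; have [/= Avu Buv eqc'] := GP (v, u) neq_uv.
have := neq_uv; rewrite -(inj_eq enum_rank_inj) -val_eqE neq_ltn.
case/orP => lt_uv; rewrite lt_uv ltnNge (ltnW lt_uv) /=; split=> // w wu wv.
by apply/esym; apply: eqc'.
Qed.

(** * Upper bound for the waste by double counting *)

Definition arcs := [set p : T * T | e p.1 p.2].

Lemma card_arcs : #|arcs| = (nedges e).*2.
Proof.
rewrite /arcs -sum1_card (partition_big (fun p => [set p.1; p.2]) (mem (edges e))) /=.
  rewrite (eq_bigr (fun=> 2)) => [|E /imset2P[x y _]].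
    by rewrite sum_nat_const muln2.
  rewrite inE => /= exy ->; have neq_xy : x != y.
    by apply: contraTneq exy => ->; rewrite e_irr.
  rewrite sum1_card (_ : #|_| = #|[set (x, y); (y, x)]|).
    by rewrite cards2 xpair_eqE negb_and neq_xy.
  apply: eq_card => -[p q]; rewrite !inE /= !xpair_eqE.
  apply/andP/orP => [[]|].
    rewrite inE /= => epq /eqP eq_pq.
    have: p \in [set x; y] by rewrite -eq_pq set21.
    have: q \in [set x; y] by rewrite -eq_pq set22.
    have neq_pq : p != q by apply: contraTneq epq => ->; rewrite e_irr.
    rewrite !inE => /orP[]/eqP def_q /orP[]/eqP def_p; move: neq_pq;
      by rewrite def_p def_q !eqxx; auto.
  case=> /andP[/eqP-> /eqP->]; rewrite inE /=; first by rewrite exy.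
  by rewrite e_sym exy setUC.
move=> [x y]; rewrite inE /= => exy; apply/imset2P.
by exists x y; rewrite ?inE.
Qed.

Variable F : T -> T -> {set T}.
Hypothesis FP : forall u v, u != v -> first_neighbours u v (F u v) /\
    forall w, w \in F u v -> w \in F v u -> col u w = col v w.

(* Triples [(u, w, v)] such that no path of the system for [u] and [v] starts with
   the edge [uw]. *)
Definition waste := [set x : T * T * T | [&& e x.1.1 x.1.2, x.2 != x.1.1,
  x.2 != x.1.2 & x.1.2 \notin F x.1.1 x.2]].

(** Among the neighbours of [u] other than [v], at least [k - e u v] lie in [F u v], and none of
    these is wasted. *)
Lemma waste_fibre u v : u != v ->
  k + #|[set x in waste | (x.1.1, x.2) == (u, v)]| <= #|[set w | e u w]|.
Proof.
move=> neq_uv; have [[Fe leF _] _] := FP neq_uv.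
set fib := [set x in waste | _].
have : [set x.1.2 | x in fib] \subset [set w | e u w] :\ v :\: F u v.
  apply/subsetP => _ /imsetP[[[u' w] v'] + ->].
  rewrite !inE /= => /andP[/and4P[euw _ neq_v wF] /eqP[<- <-]].
  by rewrite wF eq_sym neq_v.
move/subset_leq_card; rewrite card_in_imset; last first.
  move=> [[u1 w1] v1] [[u2 w2] v2]; rewrite !inE /=.
  by move=> /andP[_ /eqP[-> ->]] /andP[_ /eqP[-> ->]] ->.
rewrite cardsD (setIidPr _); last first.
  by apply/subsetP => w /Fe /andP[euw wv]; rewrite !inE wv.
have -> : #|[set w | e u w] :\ v| = #|[set w | e u w]| - e u v.
  by rewrite [in RHS](cardsD1 v) inE addKn.
have : #|F u v| + e u v <= #|[set w | e u w]|.
  rewrite (cardsD1 v [set w | e u w]) inE addnC leq_add2l; apply/subset_leq_card/subsetP => w.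
  by move=> /Fe /andP[euw wv]; rewrite !inE wv.
lia.
Qed.

Lemma waste_upper : k * (#|T| * #|T|.-1) + #|waste| <= (nedges e).*2 * #|T|.-1.
Proof.
have cardC1' (u : T) : #|[pred v | u != v]| = #|T|.-1.
  by rewrite -(cardC1 u); apply: eq_card => v; rewrite !inE eq_sym.
have -> : #|waste| = \sum_u \sum_(v | u != v)
    #|[set x in waste | (x.1.1, x.2) == (u, v)]|.
  rewrite pair_big_dep /= -sum1_card.
  rewrite (partition_big (fun x => (x.1.1, x.2)) (fun p => p.1 != p.2)) /=; last first.
    by move=> [[u w] v]; rewrite inE /= eq_sym => /and4P[].
  apply: eq_bigr => -[u v] _; rewrite -sum1_card; apply: eq_bigl => x.
  by rewrite !inE.
have -> : k * (#|T| * #|T|.-1) = \sum_(u : T) \sum_(v | u != v) k.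
  rewrite (eq_bigr (fun=> #|T|.-1 * k)) => [|u _]; last by rewrite sum_nat_const cardC1'.
  by rewrite sum_nat_const mulnC mulnA.
rewrite -big_split /= -card_arcs.
have -> : #|arcs| = \sum_u #|[set w | e u w]|.
  rewrite /arcs -sum1_card (eq_bigr (fun u => \sum_(w | e u w) 1)) => [|u _].
    by rewrite pair_big_dep; apply: eq_bigl => p; rewrite inE.
  by rewrite sum1_card; apply: eq_card => w; rewrite !inE.
rewrite big_distrl; apply: leq_sum => u _; rewrite -big_split /=.
apply: leq_trans (_ : \sum_(v | u != v) #|[set w | e u w]| <= _).
  by apply: leq_sum => v; apply: waste_fibre.
by rewrite sum_nat_const cardC1' mulnC.
Qed.

(** * Lower bound for the waste, colour by colour *)

(* The waste is shared out among the colours other than [a0]: a triple whose edge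
   [uw] has colour [a0] is credited to the colour of [vw]. *)
Definition charge a0 (t : T * T * T) :=
  if col t.1.1 t.1.2 == a0 then col t.2 t.1.2 else col t.1.1 t.1.2.

(** An arc of colour [a] inside the component [K] and a third vertex outside [K] form a wasted
    triple: a monochromatic path starting with that arc stays in [K]. *)
Lemma component_waste a0 a x y : a != a0 -> crel a x y ->
  ~ (forall z z', connect (crel a) z z') ->
  (#|T| - 2).*2 <= #|[set t in waste | charge a0 t == a]|.
Proof.
move=> neq_a cxy nconn; pose K := [set z | connect (crel a) x z].
set A := [set p : T * T | [&& p.1 \in K, p.2 \in K & crel a p.1 p.2]].
have leA : #|K|.-1.*2 <= #|A| := arcs_of_component x (@crel_sym a).
have K_ge2 : 1 < #|K|.
  apply/card_gt1P; exists x, y; split.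
  - by rewrite inE.
  - by rewrite inE connect1.
  by move: cxy => /andP[exy _]; apply: contraTneq exy => ->; rewrite e_irr.
have KC_gt0 : 0 < #|~: K|.
  rewrite lt0n cards_eq0; apply/negP => /eqP KC0; apply: nconn => z z'.
  have xz t : connect (crel a) x t.
    have : t \notin ~: K by rewrite KC0 inE.
    by rewrite !inE negbK.
  by apply: connect_trans (xz z'); rewrite connect_crelC.
apply: (@leq_trans #|setX A (~: K)|).
  rewrite cardsX; apply: leq_trans (leq_mul leA (leqnn _)); rewrite -doubleMl leq_double.
  (* With n vertices, the factors |K| - 1 and n - |K| are positive with sum n - 1, so their product
     is at least n - 2. *)
  rewrite -(cardsC K); move: K_ge2 KC_gt0.
  case: #|K| #|~: K| => [|[|s]] // [|r] // _ _.
  by rewrite addSn addSn addnS subSS subSS subn0 mulSn mulnS; lia.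
apply/subset_leq_card/subsetP => -[[u w] v]; rewrite in_setX in_setC => /andP[pA vK].
have /and3P[uK wK /andP[euw /eqP colw]] : [&& u \in K, w \in K & crel a u w].
  by rewrite inE in pA.
rewrite !inE /charge /= euw colw (negPf neq_a) eqxx andbT /=.
have vu : v != u by apply: contraNneq vK => ->.
have vw : v != w by apply: contraNneq vK => ->.
rewrite vu vw /=; apply: contraNN vK => wF.
have [|[_ _ /(_ _ wF) wv] _] := @FP u v; first by rewrite eq_sym.
by rewrite inE in wK; rewrite colw in wv; rewrite inE; apply: connect_trans wv.
Qed.

(* At a vertex [w] of both colours, an edge [uw] of colour [a] and an edge [wv] of
   colour [a0] cannot both be used by the disjoint paths between [u] and [v]. *)
Lemma spanning_waste a0 a : a != a0 -> 1 < #|T| ->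
  (forall z z', connect (crel a) z z') -> (forall z z', connect (crel a0) z z') ->
  (#|T| - 2).*2 <= #|[set t in waste | charge a0 t == a]|.
Proof.
move=> neq_a T_ge2 conn conn0.
have /choice[h hP] : forall w, exists v, crel a0 w v.
  move=> w; have /card_gt1P[x [y [_ _ neq_xy]]] := T_ge2.
  have [z neq_zw] : exists z, z != w.
    have [eq_xw|] := eqVneq x w; last by exists x.
    by exists y; rewrite -eq_xw eq_sym.
  have /connectP[[|v p] /=] := conn0 w z; last by move=> /andP[wv _] _; exists v.
  by move=> _ eq_zw; rewrite eq_zw eqxx in neq_zw.
have [x0 _] : exists x0 : T, x0 \in T by apply/card_gt0P; apply: ltnW.
set A := [set p : T * T | crel a p.1 p.2].
have leA : (#|T|.-1).*2 <= #|A|.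
  have := arcs_of_component x0 (@crel_sym a).
  have -> : [set y | connect (crel a) x0 y] = setT.
    by apply/setP => y; rewrite !inE conn.
  rewrite cardsT => /leq_trans; apply; apply/subset_leq_card/subsetP => p.
  by rewrite !inE.
apply: (@leq_trans #|A|); first by apply: leq_trans leA; lia.
(* [f] maps an arc of colour [a] to one of two candidate triples, both credited to [a]; the colour
   of the first edge tells [g] which one it was. *)
pose f (p : T * T) : T * T * T :=
  if (p, h p.2) \in waste then (p, h p.2) else ((h p.2, p.2), p.1).
pose g (t : T * T * T) := if col t.1.1 t.1.2 == a then t.1 else (t.2, t.1.2).
have colh w : col (h w) w = a0 by have /andP[_ /eqP] := hP w; rewrite colC.
have fK : {in A, cancel f g}.
  move=> [u w]; rewrite inE /= => /andP[_ cola].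
  by rewrite /f; case: ifP => _; rewrite /g /= ?cola // colh eq_sym (negPf neq_a).
rewrite -(card_in_imset (can_in_inj fK)); apply/subset_leq_card/subsetP.
move=> _ /imsetP[[u w] uwA ->].
have /andP[euw /eqP cola] : crel a u w by rewrite inE in uwA.
have /andP[ewh _] := hP w.
have neq_hu : h w != u by apply: contraNneq neq_a => eq_hu; rewrite -cola -(colh w) eq_hu.
have neq_hw : h w != w by apply: contraTneq ewh => ->; rewrite e_irr.
have neq_uw : u != w by apply: contraTneq euw => ->; rewrite e_irr.
rewrite /f /=; case: ifPn => [inW|]; first by rewrite inE inW /charge /= cola (negPf neq_a) eqxx.
rewrite !inE /charge /= euw neq_hu neq_hw /= negbK => wF.
rewrite colh eqxx cola eqxx andbT e_sym ewh eq_sym neq_hu neq_uw /=.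
apply/negP => wF'; have [|_ /(_ w wF wF')] := @FP u (h w); first by rewrite eq_sym.
by rewrite cola colh => eq_a; rewrite eq_a eqxx in neq_a.
Qed.

Lemma waste_lower : 1 < #|T| -> (ncolours e c).-1 * (#|T| - 2).*2 <= #|waste|.
Proof.
move=> T_ge2; rewrite /ncolours; set Cs := c @: edges e.
have CsP a : a \in Cs -> exists x y, crel a x y.
  move=> /imsetP[_ /imset2P[x y _ + ->] ->]; rewrite inE => /andP[_ exy].
  by exists x, y; rewrite /= /col exy eqxx.
have [->|[a1 a1Cs]] := set_0Vmem Cs; first by rewrite cards0.
pose spanning a := `[< forall z z', connect (crel a) z z' >].
(* With [a0] spanning whenever some colour is, every other colour falls under [spanning_waste] or
   [component_waste]. *)
have [a0 a0Cs a0P] : exists2 a0, a0 \in Cs & forall a, a \in Cs -> spanning a -> spanning a0.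
  have [/existsP[a /andP[aCs sa]]|/existsPn no] := boolP [exists a, (a \in Cs) && spanning a].
    by exists a.
  by exists a1 => // a aCs sa; have := no a; rewrite aCs sa.
have -> : #|waste| = \sum_a #|[set t in waste | charge a0 t == a]|.
  rewrite -sum1_card (partition_big (charge a0) predT) //=; apply: eq_bigr => a _.
  by rewrite -sum1_card; apply: eq_bigl => t; rewrite inE.
rewrite (cardsD1 a0) a0Cs /= -sum_nat_const.
apply: leq_trans (_ : \sum_(a in Cs :\ a0) #|[set t in waste | charge a0 t == a]| <= _); last first.
  by rewrite [X in X <= _]big_mkcond; apply: leq_sum => a _; case: ifP.
apply: leq_sum => a /setD1P[neq_a aCs].
have [sa|nsa] := pselect (forall z z', connect (crel a) z z').
  by apply: spanning_waste => //; apply/asboolP/(a0P a) => //; apply/asboolP.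
by have [x [y cxy]] := CsP a aCs; apply: component_waste cxy nsa.
Qed.

End Counting.

(** * The colour inequality and the two conclusions *)

Lemma mono_k_connected_ncolours (T : finType) (e : rel T) (k : nat) (C : finType)
    (c : {ffun {set T} -> C}) :
  symmetric e -> irreflexive e -> 1 < #|T| -> mono_k_connected e k c ->
  k * (#|T| * #|T|.-1) + (ncolours e c).-1 * (#|T| - 2).*2 <= (nedges e).*2 * #|T|.-1.
Proof.
move=> e_sym e_irr T_ge2 /(first_neighbours_family e_sym)[F FP].
apply: leq_trans (waste_upper e_sym e_irr FP); rewrite leq_add2l.
exact: (waste_lower e_sym e_irr FP).
Qed.

(** Put m = t + d and N = n - 2. After halving, n - 1 = N + 1 turns the hypothesis into k b - m <= d
    N, and the quotient is the ceiling of (k b - m) / N. *)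
Lemma leq_ceil_div k m t n b : 2 < n -> t <= m -> b.*2 = n * n.-1 ->
  k * (n * n.-1) + t * (n - 2).*2 <= m.*2 * n.-1 ->
  t + (k * b - m + (n - 2) - 1) %/ (n - 2) <= m.
Proof.
move=> n_ge3 /subnKC; move: (m - t) => d <- <-.
have -> : n.-1 = (n - 2).+1 by lia.
have : 0 < n - 2 by rewrite subn_gt0.
move: (n - 2) => N N_gt0; rewrite -!doubleMr -doubleD -doubleMl leq_double.
rewrite mulnS mulnDl => le_b; rewrite leq_add2l -ltnS ltn_divLR // mulSn.
by move: le_b; move: (k * b) (t * N) (d * N) => x y z; lia.
Qed.

(** From 2 m <= k n + 1 follows 2 t (n - 2) <= n - 1, which forces t = 0 once n >= 4. In the
    remaining case n = 3, k = 2 the product k n is even, so 2 m = k n. *)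
Lemma excess_colours_eq0 k m t n : 1 < k -> k < n -> m = (k * n + 1) %/ 2 ->
  k * (n * n.-1) + t * (n - 2).*2 <= m.*2 * n.-1 -> t = 0.
Proof.
move=> k_ge2 ltkn def_m.
have le_m : m.*2 <= k * n + 1 by rewrite -muln2 def_m leq_trunc_div.
have [|n_ge4] := leqP n 3 => [n_le3|].
  have [eq_n eq_k] : n = 3 /\ k = 2 by lia.
  by subst n k; lia.
case: t => // t le_b; exfalso.
have {le_b} := leq_trans le_b (leq_mul le_m (leqnn n.-1)).
rewrite mulnDl mul1n mulnA leq_add2l mulSn => /(leq_trans (leq_addr _ _)).
lia.
Qed.

Theorem theorem2p8 (T : finType) (e : rel T) (k : nat)
  (e_sym : symmetric e) (e_irr : irreflexive e)
  (hk : 2 <= k) (hn : k < #|T|) (hG : k_connected e k) :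
  ((mc e k)%:Z <=
     (nedges e)%:Z
     - ((k * 'C(#|T|, 2) - nedges e + (#|T| - 2) - 1) %/ (#|T| - 2))%:Z + 1)%R
  /\ (nedges e = (k * #|T| + 1) %/ 2 -> mc e k = 1).
Proof.
have T_ge3 : 2 < #|T| by apply: leq_ltn_trans hn.
have bound (C : finType) (c : {ffun {set T} -> C}) :=
  @mono_k_connected_ncolours T e k C c e_sym e_irr (ltnW T_ge3).
pose c1 : {ffun {set T} -> 'I_(nedges e).+1} := [ffun _ => ord0].
have c1P : mono_k_connected e k c1.
  by apply: constant_mono_k_connected => //; apply: ltnW.
have binT : 'C(#|T|, 2).*2 = #|T| * #|T|.-1.
  by rewrite -muln2 (bin_ffact _ 2) ffactnS ffactn1.
split.
  set q := _ %/ _.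
  have cq (c : {ffun {set T} -> 'I_(nedges e).+1}) :
      mono_k_connected e k c -> (ncolours e c).-1 + q <= nedges e.
    move=> /bound; apply: leq_ceil_div => //.
    by apply: leq_trans (leq_pred _) _; apply: leq_imset_card.
  (* The constant colouring yields q <= e(G), so the subtraction in [nat] does not truncate. *)
  have := cq _ c1P; suff : mc e k <= (nedges e).+1 - q by lia.
  by apply/bigmax_leqP => c /asboolP/cq; lia.
move=> def_m; apply/eqP; rewrite eqn_leq; apply/andP; split.
  apply/bigmax_leqP => c /asboolP/bound le_b.
  by have := excess_colours_eq0 hk hn def_m le_b; case: (ncolours e c) => [|[]].
apply: leq_trans (leq_bigmax_cond c1 _); last exact/asboolP.
rewrite /ncolours card_gt0; apply/set0Pn.
have /card_gt0P[E Ee] : 0 < nedges e by rewrite def_m divn_gt0 // addn1 ltnS muln_gt0; lia.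
by exists (c1 E); apply: imset_f.
Qed.
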